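(* Let $(X,\mathcal{A},\mu)$ be a measure space. Then $\mathcal{M}_\psi(X,\mathcal{A})$ is the closure of $\mathcal{M}_F(X,\mathcal{A})$ in $\mathcal{M}(X,\mathcal{A})$ with respect to the $m_\mu$-topology.
   Context: $X$ is a non-empty set, $\mathcal{A}$ a $\sigma$-algebra on $X$, $\mu:\mathcal{A}\to[0,\infty]$ a measure. $\mathcal{M}(X,\mathcal{A})$ is the commutative ring of all measurable functions $X\to\mathbb{R}$ under pointwise operations. A $\mu$-null set is a set $E\in\mathcal{A}$ with $\mu(E)=0$. A positive unit of $\mathcal{M}(X,\mathcal{A})$ is a $u\in\mathcal{M}(X,\mathcal{A})$ with $u(x)>0$ for all $x\in X$. The $m_\mu$-topology on $\mathcal{M}(X,\mathcal{A})$ has as open base the sets $m_\mu(f,u)=\{g\in\mathcal{M}(X,\mathcal{A}):$ there is a $\mu$-null set $E$ with $|f(x)-g(x)|<u(x)$ for all $x\in X\setminus E\}$, $f\in\mathcal{M}(X,\mathcal{A})$, $u$ a positive unit. $Z(f)=\{x\in X: f(x)=0\}$. $\mathcal{M}_F(X,\mathcal{A})=\{f\in\mathcal{M}(X,\mathcal{A}): \mu(X\setminus Z(f))<\infty\}$; $\mathcal{M}_\infty(X,\mathcal{A})=\{f\in\mathcal{M}(X,\mathcal{A}): \mu(\{x\in X:|f(x)|\geq\epsilon\})<\infty$ for all $\epsilon>0\}$; $\mathcal{M}_\psi(X,\mathcal{A})=\{f\in\mathcal{M}(X,\mathcal{A}): f\cdot g\in\mathcal{M}_\infty(X,\mathcal{A})$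 for all $g\in\mathcal{M}(X,\mathcal{A})\}$. *)

(* Defs.v *)
From HB Require Import structures.
From mathcomp Require Import all_boot all_order all_algebra.
From mathcomp Require Import all_classical all_reals all_analysis.
From mathcomp Require Import measurable_realfun.

Set Implicit Arguments.
Unset Strict Implicit.
Unset Printing Implicit Defensive.

Import Order.TTheory GRing.Theory Num.Theory.
Import numFieldNormedType.Exports.

Local Open Scope classical_set_scope.
Local Open Scope ring_scope.

(* The ring M(X, A) is {mfun T >-> R}, where [T : measurableType d] plays the
   role of (X, A); it is non-empty because measurable types are pointed. *)

Definition positive_unit d (T : measurableType d) (R : realType)
    (u : {mfun T >-> R}) : Prop :=
  forall x, 0 < u x.

(* [{ae mu, _}] asks for a measurable mu-null set outside of which the
   property holds. *)
Definition m_ball d (T : measurableType d) (R : realType)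
    (mu : {measure set T -> \bar R}) (f u : {mfun T >-> R}) :
    set {mfun T >-> R} :=
  [set g | {ae mu, forall x, `|f x - g x| < u x}].

Definition m_base d (T : measurableType d) (R : realType)
    (mu : {measure set T -> \bar R}) : set (set {mfun T >-> R}) :=
  [set B | exists f u, positive_unit u /\ B = m_ball mu f u].

Section m_base_is_a_base.
Context d (T : measurableType d) (R : realType).
Context (mu : {measure set T -> \bar R}).
Implicit Types f g t u : {mfun T >-> R}.

Lemma m_ball_center f u : positive_unit u -> m_ball mu f u f.
Proof. by move=> u0; apply: aeW => x; rewrite subrr normr0. Qed.

Lemma m_base_cover : \bigcup_(B in m_base mu) B = setT.
Proof.
apply/seteqP; split => // f _.
have u0 : positive_unit (1 : {mfun T >-> R}) by move=> x; rewrite mfun1.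
by exists (m_ball mu f 1); [exists f, 1|exact: m_ball_center].
Qed.

Lemma m_ball_shrink f u t : positive_unit u -> m_ball mu f u t ->
  exists2 v : {mfun T >-> R}, positive_unit v & m_ball mu t v `<=` m_ball mu f u.
Proof.
move=> u0 ft; pose w x := if `|f x - t x| < u x then u x - `|f x - t x| else 1.
have mft : measurable_fun [set: T] (fun x => `|f x - t x|).
  by apply: measurableT_comp => //; exact: measurable_funB.
have mw : measurable_fun [set: T] w.
  apply: measurable_fun_ifT => //; first exact: measurable_fun_ltr.
  exact: measurable_funB.
pose v : {mfun T >-> R} := mfun_Sub (mem_set mw).
exists v.
  move=> x; rewrite /v /= /w; case: ifPn => [|_]; last exact: ltr01.
  by rewrite subr_gt0.
move=> g tg; rewrite /m_ball /=; move: ft tg; rewrite /m_ball /=.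
apply: filterS2 => x ftx; rewrite /v /= /w ftx ltrBrDl => tgx.
apply: le_lt_trans tgx.
by rewrite -[f x - g x](subrKA (t x)) ler_normD.
Qed.

Lemma m_base_join (A B : set {mfun T >-> R}) t :
  m_base mu A -> m_base mu B -> A t -> B t ->
  exists C, [/\ m_base mu C, C t & C `<=` A `&` B].
Proof.
move=> [f [u [u0 ->]]] [g [v [v0 ->]]].
move=> /(m_ball_shrink u0)[u' u'0 sf] /(m_ball_shrink v0)[v' v'0 sg].
have w0 : positive_unit (min_mfun u' v').
  by move=> x; rewrite /= lt_min u'0 v'0.
exists (m_ball mu t (min_mfun u' v')); split.
- by exists t, (min_mfun u' v').
- exact: m_ball_center.
- move=> h th; split; [apply: sf|apply: sg]; move: th; rewrite /m_ball /=.
    by apply: filterS => x; rewrite /= lt_min => /andP[].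
  by apply: filterS => x; rewrite /= lt_min => /andP[].
Qed.

End m_base_is_a_base.

(* The ring of measurable functions equipped with the m_mu-topology; [mu] is
   kept in the type so that each measure has its own topology. *)
Definition m_space d (T : measurableType d) (R : realType)
    (mu : {measure set T -> \bar R}) : Type := {mfun T >-> R}.

Section m_topology.
Context d (T : measurableType d) (R : realType).
Context (mu : {measure set T -> \bar R}).

HB.instance Definition _ := GRing.ComNzRing.on (m_space mu).

HB.instance Definition _ := @isBaseTopological.Build (m_space mu)
  (set {mfun T >-> R}) (m_base mu) id (m_base_cover mu) (@m_base_join _ _ _ mu).

End m_topology.

Definition zero_set d (T : measurableType d) (R : realType)
    (f : {mfun T >-> R}) : set T :=
  [set x | f x = 0].

Definition M_F d (T : measurableType d) (R : realType)
    (mu : {measure set T -> \bar R}) : set {mfun T >-> R} :=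
  [set f | (mu (~` zero_set f) < +oo)%E].

Definition M_infty d (T : measurableType d) (R : realType)
    (mu : {measure set T -> \bar R}) : set {mfun T >-> R} :=
  [set f | forall eps : R, 0 < eps ->
    (mu [set x | (eps <= `|f x|)%R] < +oo)%E].

Definition M_psi d (T : measurableType d) (R : realType)
    (mu : {measure set T -> \bar R}) : set {mfun T >-> R} :=
  [set f | forall g : {mfun T >-> R}, M_infty mu (f * g)].

(* Main.v *)
(* In every ball around [f], cutting [f] off to 0 where it is smaller than the
   radius [u] gives a function supported in [u <= `|f|], i.e. in
   [1 <= `|f * u^-1|], a set of finite measure when [f] is in M_psi. Conversely
   some [h] in M_F is within [eps / (1 + `|g|)] of an adherent [f] almost
   everywhere, so that [`|f * g| < eps] almost everywhere off the support of
   [h]. *)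
Require Import Defs.
From HB Require Import structures.
From mathcomp Require Import all_boot all_order all_algebra.
From mathcomp Require Import all_classical all_reals all_analysis.
From mathcomp Require Import measurable_realfun.

Set Implicit Arguments.
Unset Strict Implicit.
Unset Printing Implicit Defensive.

Local Open Scope classical_set_scope.
Local Open Scope ring_scope.

Import Order.TTheory GRing.Theory Num.Theory.

Section positive_units.
Context d (T : measurableType d) (R : realType).
Implicit Types (f g u v : {mfun T >-> R}).

Lemma positive_unit_inv u : positive_unit u ->
  exists2 v, positive_unit v & forall x, v x = (u x)^-1.
Proof.
move=> u0.
(* The power with exponent [-1] is measurable on the whole line and agrees with the inverse at
   nonnegative reals. *)
have mv : measurable_fun [set: T] (fun x => u x `^ (-1)).
  exact: (measurableT_comp (measurable_powR (-1))).
by exists (mfun_Sub (mem_set mv)) => x /=; rewrite powR_inv1 ?invr_gt0 ?ltW.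
Qed.

Lemma measurable_norm_ge f (e : R) : measurable [set x | e <= `|f x|].
Proof.
have mf : measurable_fun [set: T] (fun x => `|f x|) by exact: measurableT_comp.
have -> : [set x | e <= `|f x|] = (fun x => `|f x|) @^-1` `[e, +oo[.
  by apply/seteqP; split => x /=; rewrite in_itv /= andbT.
by rewrite -[X in measurable X]setTI; exact: mf.
Qed.

Lemma measurable_zero_set f : measurable (zero_set f).
Proof.
by rewrite -[zero_set f]setTI; exact: (measurable_funPT f) (measurable_set1 0).
Qed.

End positive_units.

Section m_topology.
Context d (T : measurableType d) (R : realType).
Context (mu : {measure set T -> \bar R}).
Implicit Types (f g u : {mfun T >-> R}).

Lemma nbhs_m_ball f u : positive_unit u ->
  nbhs (f : m_space mu) (m_ball mu f u).
Proof.
move=> u0; rewrite nbhsE; exists (m_ball mu f u) => //; split.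
  by exists [set m_ball mu f u]; rewrite ?bigcup_set1// => _ ->; exists f, u.
exact: m_ball_center.
Qed.

(** An open set is a union of balls with arbitrary centers; the one containing [f] is recentered at
    [f] by [m_ball_shrink]. *)
Lemma nbhs_sub_m_ball f (B : set (m_space mu)) : nbhs (f : m_space mu) B ->
  exists2 u, positive_unit u & m_ball mu f u `<=` B.
Proof.
rewrite nbhsE => -[_ [[D DB <-] [A DA Af]] sB].
have [g [u [u0 Au]]] := DB _ DA.
rewrite /= Au in Af.
have [v v0 sv] := m_ball_shrink u0 Af.
exists v => // h /sv uh; apply: sB; exists A => //=.
by rewrite Au.
Qed.

Lemma M_psi_sub_closure :
  (M_psi mu : set (m_space mu)) `<=` closure (M_F mu : set (m_space mu)).
Proof.
move=> f psif B /nbhs_sub_m_ball[u u0 sB].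
have mh : measurable_fun [set: T] (fun x => if `|f x| < u x then 0 else f x).
  apply: measurable_fun_ifT => //; apply: measurable_fun_ltr => //.
  exact: measurableT_comp.
pose h : {mfun T >-> R} := mfun_Sub (mem_set mh).
exists h; split; last first.
  apply: sB; apply: aeW => x /=; case: ifPn => [|_]; first by rewrite subr0.
  by rewrite subrr normr0 u0.
have [v v0 vE] := positive_unit_inv u0.
(* Multiplying by [v] turns the varying threshold [u] into the constant 1. *)
apply: le_lt_trans (psif v 1 ltr01).
apply: le_measure; rewrite ?inE.
- exact/measurableC/measurable_zero_set.
- exact: measurable_norm_ge.
- move=> x; rewrite /zero_set /=; case: ifPn => //; rewrite -leNgt => ufx _.
  by rewrite normrM (gtr0_norm (v0 x)) vE ler_pdivlMr ?mul1r.
Qed.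

Lemma closure_sub_M_psi :
  closure (M_F mu : set (m_space mu)) `<=` (M_psi mu : set (m_space mu)).
Proof.
move=> f clf g eps eps0.
(* The inverse of this function is the radius; the summand 1 keeps it positive where [g]
   vanishes. *)
have mw : measurable_fun [set: T] (fun x => (1 + `|g x|) * eps^-1).
  apply: measurable_funM => //; apply: measurable_funD => //.
  exact: measurableT_comp.
have [|u u0 uE] := @positive_unit_inv _ _ _ (mfun_Sub (mem_set mw)).
  by move=> x /=; rewrite divr_gt0 ?ltr_wpDr.
have [h [Fh [N [mN N0 sN]]]] := clf _ (nbhs_m_ball f u0).
(* Adding the exceptional null set [N] makes the inclusion hold at every point and leaves the
   measure unchanged. *)
apply: (@le_lt_trans _ _ (mu (~` zero_set h `|` N))).
  apply: le_measure; rewrite ?inE.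
  - exact: measurable_norm_ge.
  - by apply: measurableU => //; exact/measurableC/measurable_zero_set.
  (* At a point outside both sets, [h x = 0] and the ball condition give
     [|f x| * (1 + |g x|) < eps], against [eps <= |f x| * |g x|]. *)
  - move=> x /= fgx; apply: contrapT => /not_orP[/contrapT hx] /(contra_not (sN x)).
    move=> /contrapT /=; rewrite /zero_set /= in hx.
    rewrite hx subr0 uE /= invf_div ltr_pdivlMr ?ltr_wpDr//.
    apply/negP; rewrite -leNgt; apply: le_trans fgx _.
    by rewrite normrM ler_wpM2l// lerDr.
rewrite measureU0//; exact/measurableC/measurable_zero_set.
Qed.

End m_topology.

Theorem theorem4p5 (d : measure_display) (T : measurableType d) (R : realType)
    (mu : {measure set T -> \bar R}) :
  (M_psi mu : set (m_space mu)) = closure (M_F mu : set (m_space mu)).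
Proof.
by apply/seteqP; split; [exact: M_psi_sub_closure|exact: closure_sub_M_psi].
Qed.
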